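(* Let $A,C$ be coefficient functions satisfying the standing assumptions listed in the context, let $v=v_N$ be the steady state of the Fokker-Planck equation and $w=w_N$ its normal approximation, i.e. $$v(z)=\frac{2NK}{A(z)+C(z)}\,e^{NB(z)},\qquad w(z)=\frac{2NK}{A(z^* )+C(z^* )}\,e^{Np(z)},$$ where $z^*$, $B$, $p$ and $K=K(N)$ are as defined in the context. Then for each $0<\beta<1$ there exist a constant $M>0$ and $N_0=N_0(\beta,M)\in\mathbb{N}$ such that $$|v(z)-w(z)|\le \frac{M}{N^{\beta}}\qquad\text{for all } N\ge N_0 \text{ and all } z\in[0,1].$$
   Context: Standing assumptions on $A,C$: (a1) $A,C\in C^2[0,1]$ are nonnegative functions, with $A(1)=0=C(0)$; (a2) $A+C>0$ on $[0,1]$, and $z^*$ is the unique root of $A-C$ in $[0,1]$; (a3) $A'(z^* )-C'(z^* )<0$. (Then $z^*\in(0,1)$.) $A$ and $C$ are regarded as $C^2$ functions on some fixed open interval $I\supset[0,1]$ independent of $N$ (a fixed $C^2$ extension); the conditions (a1)-(a3) are required only on $[0,1]$. Definitions. For $z\in[0,1]$, and more generally for $z\in I$ close enough to $[0,1]$ that $A+C>0$ between $z$ and $z^*$, $$B(z)=2\int_{z^*}^{z}\frac{A(x)-C(x)}{A(x)+C(x)}\,dx,\qquad q=\frac{A'(z^* )-C'(z^* )}{A(z^* )+C(z^* )}<0,\qquad p(z)=q\,(z-z^* )^2 .$$ For a positive integer $N$, large enough that $[-\frac1{2N},1+\frac1{2N}]\subset I$ and $A+C>0$ on this interval, the constant $K=K(N)>0$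 is determined by the normalization $$\int_{-1/(2N)}^{1+1/(2N)} v(z)\,dz=\frac1N,\qquad v(z)=\frac{2NK}{A(z)+C(z)}\,e^{NB(z)} .$$ The function $v$ is the stationary solution of the Fokker-Planck equation $\partial_t u=\frac1{2N}\partial_{zz}((A+C)u)-\partial_z((A-C)u)$ with boundary conditions $\frac1{2N}\partial_z((A+C)u)-(A-C)u=0$ at $z=-\frac1{2N}$ and $z=1+\frac1{2N}$, and total integral $\frac1N$. *)

(* Defs.v *)
From Stdlib Require Import Reals.
From Coquelicot Require Import Coquelicot.
Open Scope R_scope.

(* The endpoints may be infinite. *)
Definition in_interval (lo hi : Rbar) (x : R) : Prop :=
  Rbar_lt lo x /\ Rbar_lt x hi.

(* All orders k <= 2 are listed because [Derive_n] is total: [ex_derive_n f 2 x]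
   alone does not entail that [f] is differentiable at [x]. *)
Definition C2_on (lo hi : Rbar) (f : R -> R) : Prop :=
  forall x : R, in_interval lo hi x ->
    (forall k : nat, (k <= 2)%nat -> ex_derive_n f k x) /\
    continuous (Derive_n f 2) x.

Record standing_assumptions (lo hi : Rbar) (A C : R -> R) (zstar : R) : Prop := {
  sa_lo : Rbar_lt lo 0;
  sa_hi : Rbar_lt 1 hi;
  sa_A_C2 : C2_on lo hi A;
  sa_C_C2 : C2_on lo hi C;
  sa_A_nonneg : forall z : R, 0 <= z <= 1 -> 0 <= A z;
  sa_C_nonneg : forall z : R, 0 <= z <= 1 -> 0 <= C z;
  sa_A1 : A 1 = 0;
  sa_C0 : C 0 = 0;
  sa_pos : forall z : R, 0 <= z <= 1 -> 0 < A z + C z;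
  sa_zstar_range : 0 <= zstar <= 1;
  sa_zstar_root : A zstar - C zstar = 0;
  sa_zstar_unique : forall z : R, 0 <= z <= 1 -> A z - C z = 0 -> z = zstar;
  sa_slope : Derive A zstar - Derive C zstar < 0
}.

Definition Bfun (A C : R -> R) (zstar z : R) : R :=
  2 * RInt (fun x => (A x - C x) / (A x + C x)) zstar z.

Definition qcoef (A C : R -> R) (zstar : R) : R :=
  (Derive A zstar - Derive C zstar) / (A zstar + C zstar).

Definition pfun (A C : R -> R) (zstar z : R) : R :=
  qcoef A C zstar * (z - zstar) ^ 2.

Definition left_end (N : nat) : R := - (1 / (2 * INR N)).

Definition right_end (N : nat) : R := 1 + 1 / (2 * INR N).

Definition steady_state (A C : R -> R) (zstar : R) (K : nat -> R) (N : nat) (z : R) : R :=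
  2 * INR N * K N / (A z + C z) * exp (INR N * Bfun A C zstar z).

Definition normal_approx (A C : R -> R) (zstar : R) (K : nat -> R) (N : nat) (z : R) : R :=
  2 * INR N * K N / (A zstar + C zstar) * exp (INR N * pfun A C zstar z).

Definition large_enough (lo hi : Rbar) (A C : R -> R) (N : nat) : Prop :=
  (0 < N)%nat /\
  forall x : R, left_end N <= x <= right_end N ->
    in_interval lo hi x /\ 0 < A x + C x.

(* [K N] is unconstrained for the finitely many [N] that are not large enough. *)
Definition normalizing (lo hi : Rbar) (A C : R -> R) (zstar : R) (K : nat -> R) : Prop :=
  forall N : nat, large_enough lo hi A C N ->
    0 < K N /\
    is_RInt (steady_state A C zstar K N) (left_end N) (right_end N) (1 / INR N).

(* Main.v *)
Require Import Defs.
From Stdlib Require Import Reals Lra Lia Ranalysis5.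
From Coquelicot Require Import Coquelicot.
Open Scope R_scope.

(** Write [S = A + C], [g = (A - C) / S] for the drift, and [y = z - zstar], so
    that the exponent [B] has derivative [2 g] and vanishes at [zstar].

    The drift has a simple zero at [zstar] with slope [q < 0], and no other zero
    in [[0,1]].  Hence it pushes towards [zstar] with at least linear strength on
    all of [[0,1]]: [g y <= - c y^2] ([drift_restoring]).  Being twice
    differentiable, it also differs from its linear part [q y] by [O(y^2)]
    ([drift_linearization]).  Integrating these two facts gives a Gaussian bound
    [B <= - c y^2] and the cubic error [B - p = O(|y|^3)] ([Bfun_estimates]).

    Two consequences follow, each worth a factor [N^(-1/2)].
    - In [e^(N B) / S - e^(N p) / S(zstar)], replacing [S] by [S(zstar)] costs
      [O(|y|) e^(-c N y^2)], and replacing [B] by [p] costs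
      [O(N |y|^3) e^(-c N y^2)].  In the variable [u = sqrt N |y|] both are
      [N^(-1/2)] times a bounded function of [u] ([profile_difference]).
    - Since [B] is bounded below by a multiple of [- y^2], the integrand
      [e^(N B) / S] is bounded below on an interval of length of order
      [N^(-1/2)] around [zstar]; the total mass being [1/N], the prefactor
      [2 N K] is [O(N^(-1/2))] ([normalizing_constant_bound]).

    The product is [O(1/N)], which is at most [O(N^(-beta))] for [beta < 1]. *)

(** * Calculus on a segment *)

(** Parametrizing the intermediate point as [z + t (x - z)] makes the statement
    independent of the order of [z] and [x], and keeps track of the sign and
    size of its distance to [z]. *)
Lemma mvt_segment (f df : R -> R) (a b z x : R) :
  (forall y, a <= y <= b -> is_derive f y (df y)) ->
  a <= z <= b -> a <= x <= b ->
  exists t, 0 <= t <= 1 /\ f x - f z = df (z + t * (x - z)) * (x - z).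
Proof.
  intros Hd Hz Hx.
  assert (Hin : forall y, Rmin z x <= y <= Rmax z x -> a <= y <= b).
  { intros y. unfold Rmin, Rmax. destruct (Rle_dec z x); lra. }
  destruct (MVT_gen f z x df) as [c [Hc E]].
  - intros y Hy. apply Hd, Hin. lra.
  - intros y Hy. apply derivable_continuous_pt. exists (df y).
    apply is_derive_Reals, Hd, Hin, Hy.
  - destruct (Req_dec x z) as [-> | Hne].
    + exists 0. split; [lra | ring].
    + exists ((c - z) / (x - z)).
      replace (z + (c - z) / (x - z) * (x - z)) with c by (field; lra).
      split; [| exact E].
      revert Hc. unfold Rmin, Rmax. destruct (Rle_dec z x); intros Hc; split.
      * apply Rdiv_le_0_compat; lra.
      * apply (Rdiv_le_1 (c - z) (x - z)); lra.
      * replace ((c - z) / (x - z)) with ((z - c) / (z - x)) by (field; lra).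
        apply Rdiv_le_0_compat; lra.
      * replace ((c - z) / (x - z)) with ((z - c) / (z - x)) by (field; lra).
        apply (Rdiv_le_1 (z - c) (z - x)); lra.
Qed.

Lemma segment_in (a b z x t : R) :
  a <= z <= b -> a <= x <= b -> 0 <= t <= 1 -> a <= z + t * (x - z) <= b.
Proof. intros Hz Hx Ht. nra. Qed.

Lemma bounded_on_segment (f : R -> R) (a b : R) :
  a <= b -> (forall y, a <= y <= b -> continuity_pt f y) ->
  exists L, 0 <= L /\ forall y, a <= y <= b -> Rabs (f y) <= L.
Proof.
  intros Hab Hf.
  destruct (continuity_ab_maj (fun y => Rabs (f y)) a b Hab) as [m [Hm _]].
  - intros c Hc. apply (continuity_pt_comp f Rabs); [now apply Hf |].
    apply Rcontinuity_abs.
  - exists (Rabs (f m)). split; [apply Rabs_pos | exact Hm].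
Qed.

Lemma C2_is_derive (lo hi : Rbar) (f : R -> R) (x : R) :
  C2_on lo hi f -> in_interval lo hi x -> is_derive f x (Derive f x).
Proof.
  intros Hf Hx. apply Derive_correct, (proj1 (Hf x Hx) 1%nat). lia.
Qed.

Lemma C2_continuity (lo hi : Rbar) (f : R -> R) (x : R) :
  C2_on lo hi f -> in_interval lo hi x -> continuity_pt f x.
Proof.
  intros Hf Hx. apply derivable_continuous_pt. exists (Derive f x).
  apply is_derive_Reals. now apply (C2_is_derive lo hi).
Qed.

(** The mean value theorem for [f], then for its derivative between [z] and the
    intermediate point, leaves a second derivative, bounded by compactness.  The
    constant is uniform in the base point [z]. *)
Lemma C2_taylor (lo hi : Rbar) (f : R -> R) (a b : R) :
  C2_on lo hi f -> a <= b ->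
  (forall x, a <= x <= b -> in_interval lo hi x) ->
  exists L, 0 <= L /\ forall z x, a <= z <= b -> a <= x <= b ->
    Rabs (f x - f z - Derive f z * (x - z)) <= L * (x - z) ^ 2.
Proof.
  intros Hf Hab Hin.
  destruct (bounded_on_segment (Derive_n f 2) a b Hab) as [L [HL Hbd]].
  { intros y Hy. apply continuity_pt_filterlim, (proj2 (Hf y (Hin y Hy))). }
  exists L. split; [exact HL |]. intros z x Hz Hx.
  destruct (mvt_segment f (Derive f) a b z x) as [t [Ht E]]; trivial.
  { intros y Hy. apply (C2_is_derive lo hi); auto. }
  pose proof (segment_in a b z x t Hz Hx Ht) as Hc.
  destruct (mvt_segment (Derive f) (Derive_n f 2) a b z (z + t * (x - z)))
    as [s [Hs E']]; trivial.
  { intros y Hy.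
    apply (Derive_correct (Derive f)), (proj1 (Hf y (Hin y Hy)) 2%nat). lia. }
  pose proof (Hbd _ (segment_in a b z _ s Hz Hc Hs)) as Hb2.
  rewrite E.
  replace (Derive f (z + t * (x - z)) * (x - z) - Derive f z * (x - z))
    with ((Derive f (z + t * (x - z)) - Derive f z) * (x - z)) by ring.
  rewrite E'. revert Hb2. generalize (Derive_n f 2 (z + s * (z + t * (x - z) - z))).
  intros d Hd.
  replace (d * (z + t * (x - z) - z) * (x - z)) with (d * (t * (x - z) ^ 2)) by ring.
  pose proof (pow2_ge_0 (x - z)) as Hsq.
  rewrite Rabs_mult, (Rabs_pos_eq (t * (x - z) ^ 2)) by nra.
  apply Rmult_le_compat; try nra. apply Rabs_pos.
Qed.

(** The difference quotient [f x / (x - z)], completed by [l] at [z], is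
    continuous and never vanishes on [[a,b]].  It is negative at [z], hence
    everywhere by the intermediate value theorem, and its maximum over the
    compact segment is [- m]. *)
Lemma slope_bound (f : R -> R) (a b z l : R) :
  a <= z <= b -> (forall x, a <= x <= b -> continuity_pt f x) ->
  f z = 0 -> (forall x, a <= x <= b -> f x = 0 -> x = z) ->
  is_derive f z l -> l < 0 ->
  exists m, 0 < m /\
    forall x, a <= x <= b -> f x * (x - z) <= - m * (x - z) ^ 2.
Proof.
  intros Hz Hc Hfz Huniq Hd Hl.
  set (h := fun x => if Req_EM_T x z then l else f x / (x - z)).
  assert (hz : h z = l) by (unfold h; destruct (Req_EM_T z z); congruence).
  assert (hne : forall x, x <> z -> h x = f x / (x - z)).
  { intros x Hx. unfold h. destruct (Req_EM_T x z); congruence. }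
  assert (hcont : forall x, a <= x <= b -> continuity_pt h x).
  { intros x Hx. destruct (Req_dec x z) as [-> | Hne].
    - intros eps Heps. apply is_derive_Reals in Hd.
      destruct (Hd eps Heps) as [delta Hdelta].
      exists delta. split; [apply cond_pos |].
      intros y [[_ Hy] Hdist]. simpl in *. unfold Rdist in *.
      rewrite hz, hne by congruence.
      specialize (Hdelta (y - z)).
      replace (z + (y - z)) with y in Hdelta by ring. rewrite Hfz, Rminus_0_r in Hdelta.
      apply Hdelta; [| exact Hdist].
      intros H. apply Hy. lra.
    - apply (continuity_pt_ext_loc (fun y => f y / (y - z))).
      + assert (Hpos : 0 < Rabs (x - z)) by (apply Rabs_pos_lt; lra).
        exists (mkposreal _ Hpos). intros y Hy. simpl in Hy.
        symmetry. apply hne. intros ->.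
        unfold ball in Hy; simpl in Hy; unfold AbsRing_ball, abs, minus, plus, opp in Hy.
        simpl in Hy. rewrite <- Rabs_Ropp in Hy.
        replace (- (z + - x)) with (x - z) in Hy by ring. lra.
      + apply (continuity_pt_div f (fun y => y - z)); [now apply Hc | | lra].
        reg. }
  assert (hnz : forall x, a <= x <= b -> h x <> 0).
  { intros x Hx E. destruct (Req_dec x z) as [-> | Hne]; [lra |].
    rewrite hne in E by exact Hne. apply Hne, Huniq; [exact Hx |].
    replace (f x) with (f x / (x - z) * (x - z)) by (field; lra).
    rewrite E. ring. }
  destruct (continuity_ab_maj h a b) as [M [HM HMin]]; [lra | exact hcont |].
  assert (hM : h M < 0).
  { destruct (Rtotal_order (h M) 0) as [H | [H | H]]; [exact H | |].
    { destruct (hnz M HMin H). }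
    exfalso. destruct (Rtotal_order z M) as [Hlt | [Heq | Hgt]].
    - destruct (IVT_interv h z M) as [c [Hcin E]]; try lra.
      + intros y Hy. apply hcont. lra.
      + apply (hnz c); [lra | exact E].
    - rewrite <- Heq in H. lra.
    - destruct (IVT_interv (fun y => - h y) M z) as [c [Hcin E]]; try lra.
      + intros y Hy. apply (continuity_pt_opp h), hcont. lra.
      + apply (hnz c); lra. }
  exists (- h M). split; [lra |]. intros x Hx.
  destruct (Req_dec x z) as [-> | Hne]; [rewrite Hfz; lra |].
  replace (f x * (x - z)) with (h x * (x - z) ^ 2)
    by (rewrite hne by exact Hne; field; lra).
  pose proof (HM x Hx). pose proof (pow2_ge_0 (x - z)). nra.
Qed.

Lemma exp_monotone (x y : R) : x <= y -> exp x <= exp y.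
Proof. intros [H | ->]; [left; now apply exp_increasing | lra]. Qed.

Lemma exp_lipschitz (a b m : R) :
  a <= m -> b <= m -> Rabs (exp a - exp b) <= Rabs (a - b) * exp m.
Proof.
  assert (Hone : forall x y, y <= x -> x <= m -> exp x - exp y <= (x - y) * exp m).
  { intros x y Hyx Hx.
    pose proof (exp_monotone x m Hx) as Hm.
    replace (exp y) with (exp x * exp (y - x)) by (rewrite <- exp_plus; f_equal; ring).
    pose proof (exp_ineq1_le (y - x)). pose proof (exp_pos x). nra. }
  intros Ha Hb. destruct (Rle_dec b a) as [H | H].
  - rewrite !Rabs_pos_eq; [now apply Hone | lra |]. pose proof (exp_monotone b a H). lra.
  - rewrite (Rabs_minus_sym (exp a)), (Rabs_minus_sym a).
    assert (H' : a <= b) by lra. pose proof (exp_monotone a b H').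
    rewrite !Rabs_pos_eq by lra. now apply Hone.
Qed.

(** From [e^s >= (1 + s/2)^2] with [s = c u^2], the exponential dominates [1],
    [u^2] and [u^4] up to constants, and these control both [u] and [u^3]. *)
Lemma gaussian_moments (c : R) : 0 < c ->
  exists L, 0 < L /\ forall u, 0 <= u ->
    u * exp (- c * u ^ 2) <= L /\ u ^ 3 * exp (- c * u ^ 2) <= L.
Proof.
  intros Hc. exists (1 + / c + 4 / c ^ 2).
  assert (Hic : 0 < / c) by now apply Rinv_0_lt_compat.
  assert (Hic2 : 4 / c ^ 2 = 4 * (/ c) ^ 2) by (field; lra).
  rewrite Hic2. split; [nra |]. intros u Hu.
  set (s := c * u ^ 2).
  assert (Hs : 0 <= s) by (unfold s; nra).
  assert (Hu2 : u ^ 2 = s * / c) by (unfold s; field; lra).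
  assert (Hexp : (1 + s / 2) ^ 2 <= exp s).
  { replace (exp s) with (exp (s / 2) ^ 2).
    - apply pow_incr. split; [lra |]. apply exp_ineq1_le.
    - simpl. rewrite Rmult_1_r, <- exp_plus. f_equal. field. }
  assert (Hpos := exp_pos s).
  replace (- c * u ^ 2) with (- s) by (unfold s; ring). rewrite exp_Ropp.
  assert (Hmain : forall w, w <= (1 + / c + 4 * (/ c) ^ 2) * exp s ->
    w * / exp s <= 1 + / c + 4 * (/ c) ^ 2).
  { intros w Hw. apply (Rmult_le_reg_r (exp s)); [exact Hpos |].
    rewrite Rmult_assoc, Rinv_l by lra. lra. }
  assert (Hu4 : u ^ 4 = s ^ 2 * (/ c) ^ 2)
    by (replace (u ^ 4) with ((u ^ 2) ^ 2) by ring; rewrite Hu2; ring).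
  assert (E1 : 1 <= exp s) by nra.
  assert (E2 : u ^ 2 <= / c * exp s) by (rewrite Hu2; nra).
  assert (E3 : u ^ 4 <= 4 * (/ c) ^ 2 * exp s).
  { rewrite Hu4. assert (s ^ 2 <= 4 * exp s) by nra. assert (0 <= (/ c) ^ 2) by nra. nra. }
  split; apply Hmain.
  - assert (u <= 1 + u ^ 2) by nra.
    assert (0 <= u ^ 4) by (replace (u ^ 4) with ((u ^ 2) ^ 2) by ring; apply pow2_ge_0). lra.
  - assert (u ^ 3 <= u ^ 2 + u ^ 4).
    { replace (u ^ 4) with (u ^ 2 * u ^ 2) by ring.
      replace (u ^ 3) with (u ^ 2 * u) by ring.
      assert (u <= 1 + u ^ 2) by nra. pose proof (pow2_ge_0 u). nra. }
    lra.
Qed.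

Lemma is_RInt_lower_bound (f : R -> R) (a b c d m I : R) :
  is_RInt f a b I -> a <= c -> c <= d -> d <= b ->
  (forall x, a < x < b -> 0 <= f x) -> (forall x, c < x < d -> m <= f x) ->
  m * (d - c) <= I.
Proof.
  intros HI Hac Hcd Hdb Hpos Hm.
  assert (Hab : ex_RInt f a b) by now exists I.
  assert (Hcb : ex_RInt f c b) by (apply (ex_RInt_Chasles_2 f a c b); [lra | exact Hab]).
  assert (Hac' : ex_RInt f a c) by (apply (ex_RInt_Chasles_1 f a c b); [lra | exact Hab]).
  assert (Hdb' : ex_RInt f d b) by (apply (ex_RInt_Chasles_2 f c d b); [lra | exact Hcb]).
  assert (Hcd' : ex_RInt f c d) by (apply (ex_RInt_Chasles_1 f c d b); [lra | exact Hcb]).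
  rewrite <- (is_RInt_unique f a b I HI).
  rewrite <- (RInt_Chasles f a c b), <- (RInt_Chasles f c d b); trivial.
  assert (E : RInt (fun _ => m) c d = m * (d - c)).
  { rewrite RInt_const. unfold scal; simpl; unfold mult; simpl. ring. }
  rewrite <- E.
  assert (RInt (fun _ => m) c d <= RInt f c d).
  { apply RInt_le; trivial. apply ex_RInt_const. }
  assert (0 <= RInt f a c) by (apply RInt_ge_0; trivial; intros; apply Hpos; lra).
  assert (0 <= RInt f d b) by (apply RInt_ge_0; trivial; intros; apply Hpos; lra).
  unfold plus; simpl. lra.
Qed.

(** * The drift and the exponent on the unit interval *)

Definition drift (A C : R -> R) (x : R) : R := (A x - C x) / (A x + C x).

(** Positivity of [A + C] and membership in the domain are open conditions, so
    they persist slightly beyond both endpoints.  This serves to differentiate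
    [Bfun] at [0] and [1] and to show that large [N] are admissible. *)
Lemma admissible_neighbourhood (lo hi : Rbar) (A C : R -> R) (zstar : R) :
  standing_assumptions lo hi A C zstar ->
  exists eps, 0 < eps /\ forall x, - eps < x < 1 + eps ->
    in_interval lo hi x /\ 0 < A x + C x.
Proof.
  intros H.
  assert (Hin : forall x, 0 <= x <= 1 -> in_interval lo hi x).
  { intros x Hx. split.
    - apply (Rbar_lt_le_trans _ 0); [apply (sa_lo _ _ _ _ _ H) | simpl; lra].
    - apply (Rbar_le_lt_trans _ 1); [simpl; lra | apply (sa_hi _ _ _ _ _ H)]. }
  assert (Hloc : forall x, 0 <= x <= 1 ->
    locally x (fun y => in_interval lo hi y /\ 0 < A y + C y)).
  { intros x Hx. pose proof (Hin x Hx) as [Hlo Hhi].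
    repeat apply filter_and.
    - exact (open_Rbar_gt lo x Hlo).
    - exact (open_Rbar_lt hi x Hhi).
    - assert (Hc : continuity_pt (fun y => A y + C y) x).
      { apply continuity_pt_plus; eapply C2_continuity;
          eauto using sa_A_C2, sa_C_C2. }
      apply continuity_pt_filterlim in Hc. apply Hc.
      apply (open_gt 0). now apply (sa_pos _ _ _ _ _ H). }
  destruct (Hloc 0) as [e0 He0]; [lra |].
  destruct (Hloc 1) as [e1 He1]; [lra |].
  exists (Rmin e0 e1). split.
  { apply Rmin_pos; apply cond_pos. }
  intros x Hx. pose proof (Rmin_l e0 e1). pose proof (Rmin_r e0 e1).
  destruct (Rlt_le_dec x 0) as [Hx0 | Hx0].
  - apply He0. change (Rabs (x - 0) < e0). rewrite Rabs_left; lra.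
  - destruct (Rle_lt_dec x 1) as [Hx1 | Hx1].
    + split; [now apply Hin | now apply (sa_pos _ _ _ _ _ H)].
    + apply He1. change (Rabs (x - 1) < e1). rewrite Rabs_pos_eq; lra.
Qed.

Lemma in_interval_unit (lo hi : Rbar) (A C : R -> R) (zstar x : R) :
  standing_assumptions lo hi A C zstar -> 0 <= x <= 1 -> in_interval lo hi x.
Proof.
  intros H Hx. destruct (admissible_neighbourhood _ _ _ _ _ H) as [eps [He Hn]].
  apply Hn. lra.
Qed.

Lemma large_enough_eventually (lo hi : Rbar) (A C : R -> R) (zstar : R) :
  standing_assumptions lo hi A C zstar ->
  exists N1 : nat, forall N, (0 < N)%nat -> (N1 <= N)%nat -> large_enough lo hi A C N.
Proof.
  intros H. destruct (admissible_neighbourhood _ _ _ _ _ H) as [eps [He Hn]].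
  destruct (nfloor_ex (/ eps)) as [n [_ Hlt]].
  { left. now apply Rinv_0_lt_compat. }
  exists (S n). intros N HN0 HN. split; [exact HN0 |].
  apply le_INR in HN. rewrite S_INR in HN.
  assert (Hsmall : 1 / (2 * INR N) < eps).
  { assert (0 < / eps) by now apply Rinv_0_lt_compat.
    apply (Rmult_lt_reg_r (2 * INR N)); [lra |].
    replace (1 / (2 * INR N) * (2 * INR N)) with (eps * / eps) by (field; lra).
    nra. }
  unfold left_end, right_end. intros x Hx. apply Hn. lra.
Qed.

Lemma is_derive_Bfun (lo hi : Rbar) (A C : R -> R) (zstar z : R) :
  standing_assumptions lo hi A C zstar -> 0 <= z <= 1 ->
  is_derive (Bfun A C zstar) z (2 * drift A C z).
Proof.
  intros H Hz. destruct (admissible_neighbourhood _ _ _ _ _ H) as [eps [He Hn]].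
  pose proof (sa_zstar_range _ _ _ _ _ H) as Hzs.
  assert (Hcont : forall x, - eps < x < 1 + eps -> continuous (drift A C) x).
  { intros x Hx. destruct (Hn x Hx) as [Hin Hpos].
    apply continuity_pt_filterlim.
    apply (continuity_pt_div (fun x => A x - C x) (fun x => A x + C x)); [| | lra].
    - apply continuity_pt_minus; eapply C2_continuity; eauto using sa_A_C2, sa_C_C2.
    - apply continuity_pt_plus; eapply C2_continuity; eauto using sa_A_C2, sa_C_C2. }
  apply (is_derive_scal (fun y => RInt (drift A C) zstar y)).
  apply (is_derive_RInt (drift A C) _ zstar).
  - exists (mkposreal eps He). intros x Hx.
    change (Rabs (x - z) < eps) in Hx. apply Rabs_def2 in Hx.
    apply (RInt_correct (drift A C)), (ex_RInt_continuous (drift A C)).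
    intros y Hy. apply Hcont.
    revert Hy. unfold Rmin, Rmax. destruct (Rle_dec zstar x); lra.
  - apply Hcont. lra.
Qed.

Lemma Bfun_zstar (A C : R -> R) (zstar : R) : Bfun A C zstar zstar = 0.
Proof.
  unfold Bfun. rewrite RInt_point. unfold zero; simpl. ring.
Qed.

Lemma sum_bounds (lo hi : Rbar) (A C : R -> R) (zstar : R) :
  standing_assumptions lo hi A C zstar ->
  exists s T, 0 < s /\ forall x, 0 <= x <= 1 -> s <= A x + C x <= T.
Proof.
  intros H.
  assert (Hc : forall x, 0 <= x <= 1 -> continuity_pt (fun y => A y + C y) x).
  { intros x Hx. apply (in_interval_unit _ _ _ _ _ x H) in Hx.
    apply continuity_pt_plus; eapply C2_continuity; eauto using sa_A_C2, sa_C_C2. }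
  destruct (continuity_ab_min _ 0 1 Rle_0_1 Hc) as [m [Hm Hmin]].
  destruct (continuity_ab_maj _ 0 1 Rle_0_1 Hc) as [M [HM _]].
  exists (A m + C m), (A M + C M).
  split; [now apply (sa_pos _ _ _ _ _ H) |].
  intros x Hx. split; [now apply Hm | now apply HM].
Qed.

Lemma inv_sum_lipschitz (lo hi : Rbar) (A C : R -> R) (zstar : R) :
  standing_assumptions lo hi A C zstar ->
  exists L, 0 <= L /\ forall x, 0 <= x <= 1 ->
    Rabs (/ (A x + C x) - / (A zstar + C zstar)) <= L * Rabs (x - zstar).
Proof.
  intros H. pose proof (sa_zstar_range _ _ _ _ _ H) as Hzs.
  destruct (sum_bounds _ _ _ _ _ H) as [s [T [Hs Hb]]].
  destruct (C2_taylor lo hi A 0 1) as [LA [HLA HA]];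
    [eauto using sa_A_C2 | lra | eauto using in_interval_unit |].
  destruct (C2_taylor lo hi C 0 1) as [LC [HLC HC]];
    [eauto using sa_C_C2 | lra | eauto using in_interval_unit |].
  set (a := Derive A zstar) in *. set (c := Derive C zstar) in *.
  exists ((LA + LC + Rabs (a + c)) / s ^ 2). split.
  { apply Rdiv_le_0_compat; [| nra]. pose proof (Rabs_pos (a + c)). lra. }
  intros x Hx.
  pose proof (Hb x Hx) as [Hbx _]. pose proof (Hb zstar Hzs) as [Hbz _].
  specialize (HA zstar x Hzs Hx). specialize (HC zstar x Hzs Hx).
  fold a in HA. fold c in HC.
  set (y := x - zstar) in *.
  assert (Hy1 : Rabs y <= 1) by (apply Rabs_le; unfold y; lra).
  assert (Hy2 : y ^ 2 <= Rabs y)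
    by (rewrite <- (pow2_abs y); pose proof (Rabs_pos y); nra).
  assert (Hdiff : Rabs (A x + C x - (A zstar + C zstar))
                  <= (LA + LC + Rabs (a + c)) * Rabs y).
  { replace (A x + C x - (A zstar + C zstar)) with
      ((A x - A zstar - a * y) + (C x - C zstar - c * y) + (a + c) * y) by ring.
    eapply Rle_trans; [apply Rabs_triang |].
    rewrite Rabs_mult.
    pose proof (Rabs_triang (A x - A zstar - a * y) (C x - C zstar - c * y)).
    nra. }
  replace (/ (A x + C x) - / (A zstar + C zstar)) with
    (- (A x + C x - (A zstar + C zstar)) * / ((A x + C x) * (A zstar + C zstar)))
    by (field; lra).
  rewrite Rabs_mult, Rabs_Ropp.
  assert (Hss : s ^ 2 <= (A x + C x) * (A zstar + C zstar)) by nra.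
  assert (Hs2 : 0 < s ^ 2) by nra.
  rewrite (Rabs_pos_eq (/ _)) by (left; apply Rinv_0_lt_compat; lra).
  replace ((LA + LC + Rabs (a + c)) / s ^ 2 * Rabs y)
    with ((LA + LC + Rabs (a + c)) * Rabs y * / s ^ 2) by (field; lra).
  apply Rmult_le_compat; [apply Rabs_pos | | exact Hdiff |].
  - left. apply Rinv_0_lt_compat. lra.
  - now apply Rinv_le_contravar.
Qed.

(** [A - C] is its linear part up to [O(y^2)] by Taylor, and dividing by
    [A + C] instead of its value at [zstar] changes that linear part by another
    [O(y^2)]. *)
Lemma drift_linearization (lo hi : Rbar) (A C : R -> R) (zstar : R) :
  standing_assumptions lo hi A C zstar ->
  exists L, 0 <= L /\ forall x, 0 <= x <= 1 ->
    Rabs (drift A C x - qcoef A C zstar * (x - zstar)) <= L * (x - zstar) ^ 2.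
Proof.
  intros H. pose proof (sa_zstar_range _ _ _ _ _ H) as Hzs.
  destruct (sum_bounds _ _ _ _ _ H) as [s [T [Hs Hb]]].
  destruct (inv_sum_lipschitz _ _ _ _ _ H) as [LS [HLS HS]].
  destruct (C2_taylor lo hi A 0 1) as [LA [HLA HA]];
    [eauto using sa_A_C2 | lra | eauto using in_interval_unit |].
  destruct (C2_taylor lo hi C 0 1) as [LC [HLC HC]];
    [eauto using sa_C_C2 | lra | eauto using in_interval_unit |].
  pose proof (sa_zstar_root _ _ _ _ _ H) as Hroot.
  set (a := Derive A zstar) in *. set (c := Derive C zstar) in *.
  assert (His : 0 < / s) by now apply Rinv_0_lt_compat.
  pose proof (Rabs_pos (a - c)) as Hac.
  exists ((LA + LC) * / s + Rabs (a - c) * LS). split; [nra |].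
  intros x Hx.
  pose proof (Hb x Hx) as [Hbx _]. pose proof (Hb zstar Hzs) as [Hbz _].
  specialize (HA zstar x Hzs Hx). specialize (HC zstar x Hzs Hx).
  specialize (HS x Hx). fold a in HA. fold c in HC.
  unfold drift, qcoef. fold a c.
  set (y := x - zstar) in *.
  replace ((A x - C x) / (A x + C x) - (a - c) / (A zstar + C zstar) * y) with
    (((A x - A zstar - a * y) - (C x - C zstar - c * y)) * / (A x + C x)
     + (a - c) * ((/ (A x + C x) - / (A zstar + C zstar)) * y))
    by (replace (A zstar) with (C zstar) by lra; field; lra).
  eapply Rle_trans; [apply Rabs_triang |].
  rewrite Rmult_plus_distr_r. apply Rplus_le_compat.
  - rewrite Rabs_mult, (Rabs_pos_eq (/ _)) by (left; apply Rinv_0_lt_compat; lra).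
    replace ((LA + LC) * / s * y ^ 2) with ((LA + LC) * y ^ 2 * / s) by ring.
    apply Rmult_le_compat.
    + apply Rabs_pos.
    + left. apply Rinv_0_lt_compat. lra.
    + unfold Rminus at 1. eapply Rle_trans; [apply Rabs_triang |].
      rewrite Rabs_Ropp. lra.
    + apply Rinv_le_contravar; lra.
  - rewrite !Rabs_mult, Rmult_assoc. apply Rmult_le_compat_l; [exact Hac |].
    rewrite <- (pow2_abs y). pose proof (Rabs_pos y). nra.
Qed.

(** The sign information comes from [slope_bound] for [A - C], where the
    uniqueness of the root is essential; dividing by [A + C], which is bounded
    above, only changes the constant. *)
Lemma drift_restoring (lo hi : Rbar) (A C : R -> R) (zstar : R) :
  standing_assumptions lo hi A C zstar ->
  exists c, 0 < c /\ forall x, 0 <= x <= 1 ->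
    drift A C x * (x - zstar) <= - c * (x - zstar) ^ 2.
Proof.
  intros H. pose proof (sa_zstar_range _ _ _ _ _ H) as Hzs.
  destruct (sum_bounds _ _ _ _ _ H) as [s [T [Hs Hb]]].
  pose proof (Hb zstar Hzs) as HbT.
  destruct (slope_bound (fun x => A x - C x) 0 1 zstar
              (Derive A zstar - Derive C zstar)) as [m [Hm Hslope]]; trivial.
  - intros x Hx. apply (in_interval_unit _ _ _ _ _ x H) in Hx.
    apply continuity_pt_minus; eapply C2_continuity; eauto using sa_A_C2, sa_C_C2.
  - apply (sa_zstar_root _ _ _ _ _ H).
  - apply (sa_zstar_unique _ _ _ _ _ H).
  - apply (is_derive_minus A C);
      eapply C2_is_derive; eauto using sa_A_C2, sa_C_C2, in_interval_unit.
  - apply (sa_slope _ _ _ _ _ H).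
  - exists (m * / T). split; [apply Rmult_lt_0_compat; [lra |];
      apply Rinv_0_lt_compat; lra |].
    intros x Hx. pose proof (Hb x Hx) as HbX. specialize (Hslope x Hx).
    unfold drift.
    replace ((A x - C x) / (A x + C x) * (x - zstar))
      with ((A x - C x) * (x - zstar) * / (A x + C x)) by (field; lra).
    assert (Hi : / T <= / (A x + C x)) by (apply Rinv_le_contravar; lra).
    assert (0 < / T) by (apply Rinv_0_lt_compat; lra).
    pose proof (pow2_ge_0 (x - zstar)) as Hsq.
    assert (0 <= m * (x - zstar) ^ 2) by nra.
    nra.
Qed.

(** Both estimates come from the mean value theorem applied to [B + c y^2] and
    to [B - p], which vanish at [zstar] and whose derivatives are controlled by
    [drift_restoring] and [drift_linearization].  The same [c] must serve for
    [B] and [p], since both exponentials are later bounded by one Gaussian. *)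
Lemma Bfun_estimates (lo hi : Rbar) (A C : R -> R) (zstar : R) :
  standing_assumptions lo hi A C zstar ->
  exists c L, 0 < c /\ 0 <= L /\ forall z, 0 <= z <= 1 ->
    Bfun A C zstar z <= - c * (z - zstar) ^ 2 /\
    pfun A C zstar z <= - c * (z - zstar) ^ 2 /\
    Rabs (Bfun A C zstar z - pfun A C zstar z) <= L * Rabs (z - zstar) ^ 3.
Proof.
  intros H. pose proof (sa_zstar_range _ _ _ _ _ H) as Hzs.
  destruct (drift_linearization _ _ _ _ _ H) as [L [HL Hlin]].
  destruct (drift_restoring _ _ _ _ _ H) as [c [Hc Hrest]].
  assert (Hq : 0 < - qcoef A C zstar).
  { unfold qcoef. rewrite <- Rdiv_opp_l. apply Rdiv_lt_0_compat.
    - pose proof (sa_slope _ _ _ _ _ H). lra.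
    - now apply (sa_pos _ _ _ _ _ H). }
  exists (Rmin c (- qcoef A C zstar)), (2 * L).
  split; [now apply Rmin_pos |]. split; [lra |]. intros z Hz.
  pose proof (Bfun_zstar A C zstar) as HB0.
  pose proof (Rmin_l c (- qcoef A C zstar)) as Hminl.
  pose proof (Rmin_r c (- qcoef A C zstar)) as Hminr.
  set (k := Rmin c (- qcoef A C zstar)) in *.
  pose proof (pow2_ge_0 (z - zstar)) as Hsq.
  split; [| split].
  - apply (Rle_trans _ (- c * (z - zstar) ^ 2)); [| nra].
    set (y := z - zstar) in *.
    destruct (mvt_segment (fun x => Bfun A C zstar x + c * (x - zstar) ^ 2)
        (fun x => 2 * drift A C x + c * (2 * (x - zstar))) 0 1 zstar z)
      as [t [Ht E]]; trivial.
    { intros x Hx. apply (is_derive_plus (Bfun A C zstar)).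
      - now apply (is_derive_Bfun lo hi).
      - auto_derive; trivial. ring. }
    pose proof (Hrest _ (segment_in 0 1 zstar z t Hzs Hz Ht)) as Hr.
    cbv beta in E. fold y in E, Hr. rewrite HB0 in E.
    replace (zstar + t * y - zstar) with (t * y) in E, Hr by ring.
    (* The restoring bound at [zstar + t y] carries an extra factor [t], removed
       here; at [t = 0] the drift itself vanishes. *)
    assert (Hneg : (drift A C (zstar + t * y) + c * (t * y)) * y <= 0).
    { destruct (Req_dec t 0) as [-> | Hne].
      - rewrite Rmult_0_l, Rplus_0_r. unfold drift.
        rewrite (sa_zstar_root _ _ _ _ _ H). unfold Rdiv. lra.
      - apply (Rmult_le_reg_l t); nra. }
    nra.
  - unfold pfun. nra.
  - set (y := z - zstar) in *.
    destruct (mvt_segment (fun x => Bfun A C zstar x - pfun A C zstar x)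
        (fun x => 2 * drift A C x - qcoef A C zstar * (2 * (x - zstar))) 0 1 zstar z)
      as [t [Ht E]]; trivial.
    { intros x Hx. apply (is_derive_minus (Bfun A C zstar)).
      - now apply (is_derive_Bfun lo hi).
      - unfold pfun. auto_derive; trivial. ring. }
    pose proof (Hlin _ (segment_in 0 1 zstar z t Hzs Hz Ht)) as Hl.
    cbv beta in E. fold y in E, Hl. rewrite HB0 in E.
    replace (pfun A C zstar zstar) with 0 in E by (unfold pfun; ring).
    rewrite !Rminus_0_r in E. rewrite E.
    replace (zstar + t * y - zstar) with (t * y) in * by ring.
    replace (2 * drift A C (zstar + t * y) - qcoef A C zstar * (2 * (t * y)))
      with (2 * (drift A C (zstar + t * y) - qcoef A C zstar * (t * y))) by ring.
    rewrite !Rabs_mult, (Rabs_pos_eq 2) by lra.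
    replace (2 * L * Rabs y ^ 3) with (2 * (L * y ^ 2) * Rabs y)
      by (rewrite <- (pow2_abs y); ring).
    apply Rmult_le_compat_r; [apply Rabs_pos |].
    assert (L * (t * y) ^ 2 <= L * y ^ 2).
    { apply Rmult_le_compat_l; [exact HL |].
      replace ((t * y) ^ 2) with (t ^ 2 * y ^ 2) by ring.
      pose proof (pow2_ge_0 y). assert (t ^ 2 <= 1) by nra. nra. }
    lra.
Qed.

(** * The normalizing constant and the profiles *)

(** The mass [1/N] bounds from above the contribution of a window of width
    [h = 1 / (2 sqrt N)] on one side of [zstar], where [N B] is at least [- Q].
    Since [h <= 1/2], the window can be placed inside [[0,1]] to the right of
    [zstar] if [zstar <= 1/2], and to its left otherwise. *)
Lemma normalizing_constant_bound (lo hi : Rbar) (A C : R -> R) (zstar : R) (K : nat -> R) :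
  standing_assumptions lo hi A C zstar -> normalizing lo hi A C zstar K ->
  exists M, 0 < M /\ forall N, large_enough lo hi A C N ->
    0 < K N /\ 2 * INR N * K N <= M / sqrt (INR N).
Proof.
  intros H HK. pose proof (sa_zstar_range _ _ _ _ _ H) as Hzs.
  destruct (sum_bounds _ _ _ _ _ H) as [s [T [Hs Hb]]].
  destruct (Bfun_estimates _ _ _ _ _ H) as [c0 [L [_ [HL HB]]]].
  set (Q := Rabs (qcoef A C zstar) + L).
  assert (HQ : forall z, 0 <= z <= 1 -> - Q * (z - zstar) ^ 2 <= Bfun A C zstar z).
  { intros z Hz. destruct (HB z Hz) as [_ [_ Hd]].
    assert (Hy : Rabs (z - zstar) <= 1) by (apply Rabs_le; lra).
    assert (Hcube : Rabs (z - zstar) ^ 3 <= (z - zstar) ^ 2).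
    { rewrite <- (pow2_abs (z - zstar)). pose proof (Rabs_pos (z - zstar)). nra. }
    pose proof (Rabs_maj2 (qcoef A C zstar)). pose proof (pow2_ge_0 (z - zstar)).
    pose proof (Rabs_maj2 (Bfun A C zstar z - pfun A C zstar z)) as Hd'.
    unfold pfun in *. unfold Q. nra. }
  assert (HQ0 : 0 <= Q) by (unfold Q; pose proof (Rabs_pos (qcoef A C zstar)); lra).
  assert (HT : 0 < T) by (pose proof (Hb zstar Hzs); lra).
  exists (2 * T * exp Q). split.
  { pose proof (exp_pos Q). nra. }
  intros N HN. destruct (HK N HN) as [HKpos Hint]. split; [exact HKpos |].
  destruct HN as [HN0 HN].
  assert (HN1 : 1 <= INR N) by (apply (le_INR 1); lia).
  set (n := INR N) in *. set (r := sqrt n).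
  assert (Hr2 : r * r = n) by (apply sqrt_sqrt; lra).
  assert (Hr1 : 1 <= r) by (rewrite <- sqrt_1; apply sqrt_le_1; lra).
  set (h := / (2 * r)).
  assert (Hhr : 2 * r * h = 1) by (unfold h; field; lra).
  assert (Hh : 0 < h) by (unfold h; apply Rinv_0_lt_compat; lra).
  assert (Hh2 : h <= 1 / 2) by nra.
  assert (Hends : left_end N <= 0 /\ 1 <= right_end N).
  { unfold left_end, right_end. fold n.
    assert (0 < 1 / (2 * n)) by (apply Rdiv_lt_0_compat; lra). lra. }
  assert (Hlow : forall x, 0 <= x <= 1 -> - h <= x - zstar <= h ->
    2 * n * K N / T * exp (- Q) <= steady_state A C zstar K N x).
  { intros x Hx Hxh. unfold steady_state. fold n.
    pose proof (Hb x Hx) as HbX.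
    assert (0 < 2 * n * K N) by nra.
    apply Rmult_le_compat.
    - left. apply Rdiv_lt_0_compat; lra.
    - left. apply exp_pos.
    - apply Rmult_le_compat_l; [lra |]. apply Rinv_le_contravar; lra.
    - apply exp_monotone. pose proof (HQ x Hx) as HQx.
      assert (Hsq : (x - zstar) ^ 2 <= h ^ 2) by nra.
      assert (n * h ^ 2 <= 1) by (rewrite <- Hr2; nra).
      assert (n * (x - zstar) ^ 2 <= 1) by nra.
      nra. }
  assert (Hmass : 2 * n * K N / T * exp (- Q) * h <= 1 / n).
  { assert (Hpos : forall x, left_end N < x < right_end N ->
      0 <= steady_state A C zstar K N x).
    { intros x Hx. unfold steady_state. fold n.
      destruct (HN x) as [_ HS]; [lra |].
      apply Rmult_le_pos; [| left; apply exp_pos].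
      left. apply Rdiv_lt_0_compat; nra. }
    destruct (Rle_dec zstar (1 / 2)) as [Hhalf | Hhalf].
    - replace h with (zstar + h - zstar) at 1 by ring.
      apply (is_RInt_lower_bound (steady_state A C zstar K N)
               (left_end N) (right_end N)); trivial; try lra.
      intros x Hx. apply Hlow; lra.
    - replace h with (zstar - (zstar - h)) at 1 by ring.
      apply (is_RInt_lower_bound (steady_state A C zstar K N)
               (left_end N) (right_end N)); trivial; try lra.
      intros x Hx. apply Hlow; lra. }
  rewrite exp_Ropp in Hmass. pose proof (exp_pos Q) as HeQ.
  replace (2 * n * K N) with
    (2 * n * K N / T * / exp Q * h * (2 * r * (T * exp Q)))
    by (unfold h; field; lra).
  replace (2 * T * exp Q / r) with (1 / n * (2 * r * (T * exp Q)))
    by (rewrite <- Hr2; field; lra).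
  apply Rmult_le_compat_r; [| exact Hmass].
  assert (0 < T * exp Q) by nra. nra.
Qed.

(** Both errors are a power of [|y|] times the Gaussian [e^(-c n y^2)]; the
    factor [n] that comes with the cubic one is exactly what makes the two scale
    alike when [y] is measured in units of [1 / sqrt n]. *)
Lemma profile_difference (lo hi : Rbar) (A C : R -> R) (zstar : R) :
  standing_assumptions lo hi A C zstar ->
  exists M, 0 < M /\ forall n z, 0 < n -> 0 <= z <= 1 ->
    Rabs (/ (A z + C z) * exp (n * Bfun A C zstar z)
          - / (A zstar + C zstar) * exp (n * pfun A C zstar z)) <= M / sqrt n.
Proof.
  intros H. pose proof (sa_zstar_range _ _ _ _ _ H) as Hzs.
  destruct (inv_sum_lipschitz _ _ _ _ _ H) as [LS [HLS HS]].
  destruct (Bfun_estimates _ _ _ _ _ H) as [c [L [Hc [HL HB]]]].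
  destruct (gaussian_moments c Hc) as [G [HG Hmom]].
  set (S0 := / (A zstar + C zstar)) in *.
  assert (HS0 : 0 < S0) by (apply Rinv_0_lt_compat, (sa_pos _ _ _ _ _ H), Hzs).
  (* The summand [1] keeps the constant positive if [LS] and [L] vanish. *)
  exists ((LS + S0 * L + 1) * G). split.
  { apply Rmult_lt_0_compat; [nra | exact HG]. }
  intros n z Hn Hz. destruct (HB z Hz) as [HBz [Hpz Hdz]]. specialize (HS z Hz).
  set (y := Rabs (z - zstar)) in *.
  assert (Hy : 0 <= y) by apply Rabs_pos.
  rewrite <- (pow2_abs (z - zstar)) in HBz, Hpz. fold y in HBz, Hpz.
  set (r := sqrt n).
  assert (Hr : 0 < r) by now apply sqrt_lt_R0.
  assert (Hr2 : r * r = n) by (apply sqrt_sqrt; lra).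
  set (B := Bfun A C zstar z) in *. set (p := pfun A C zstar z) in *.
  assert (HnB : n * B <= - c * (r * y) ^ 2).
  { replace (- c * (r * y) ^ 2) with (n * (- c * y ^ 2)) by (rewrite <- Hr2; ring).
    apply Rmult_le_compat_l; lra. }
  assert (Hnp : n * p <= - c * (r * y) ^ 2).
  { replace (- c * (r * y) ^ 2) with (n * (- c * y ^ 2)) by (rewrite <- Hr2; ring).
    apply Rmult_le_compat_l; lra. }
  pose proof (exp_lipschitz _ _ _ HnB Hnp) as Hexp.
  destruct (Hmom (r * y)) as [Hm1 Hm3]; [nra |].
  set (e := exp (- c * (r * y) ^ 2)) in *.
  assert (He : 0 < e) by apply exp_pos.
  assert (HeB : exp (n * B) <= e) by now apply exp_monotone.
  (* The first term changes the amplitude, the second the exponent. *)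
  replace (/ (A z + C z) * exp (n * B) - S0 * exp (n * p)) with
    ((/ (A z + C z) - S0) * exp (n * B) + S0 * (exp (n * B) - exp (n * p))) by ring.
  assert (Hfirst : Rabs ((/ (A z + C z) - S0) * exp (n * B)) <= LS * (G / r)).
  { rewrite Rabs_mult, (Rabs_pos_eq (exp _)) by (left; apply exp_pos).
    apply (Rle_trans _ (LS * y * e)).
    - apply Rmult_le_compat; trivial; [apply Rabs_pos | left; apply exp_pos].
    - replace (LS * y * e) with (LS * (r * y * e / r)) by (field; lra).
      apply Rmult_le_compat_l; [exact HLS |].
      apply Rmult_le_compat_r; [left; now apply Rinv_0_lt_compat | exact Hm1]. }
  assert (Hsecond : Rabs (S0 * (exp (n * B) - exp (n * p))) <= S0 * L * (G / r)).
  { rewrite Rabs_mult, (Rabs_pos_eq S0), Rmult_assoc by lra.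
    apply Rmult_le_compat_l; [lra |].
    eapply Rle_trans; [exact Hexp |].
    replace (n * B - n * p) with (n * (B - p)) by ring.
    rewrite Rabs_mult, (Rabs_pos_eq n) by lra.
    apply (Rle_trans _ (n * (L * y ^ 3) * e)).
    - apply Rmult_le_compat_r; [lra |]. apply Rmult_le_compat_l; lra.
    - replace (n * (L * y ^ 3) * e) with (L * ((r * y) ^ 3 * e / r))
        by (rewrite <- Hr2; field; lra).
      apply Rmult_le_compat_l; [exact HL |].
      apply Rmult_le_compat_r; [left; now apply Rinv_0_lt_compat | exact Hm3]. }
  eapply Rle_trans; [apply Rabs_triang |].
  assert (0 < G / r) by (apply Rdiv_lt_0_compat; lra).
  replace ((LS + S0 * L + 1) * G / r) with ((LS + S0 * L + 1) * (G / r))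
    by (field; lra).
  lra.
Qed.

Theorem theorem1 (lo hi : Rbar) (A C : R -> R) (zstar : R) (K : nat -> R)
  (hAC : standing_assumptions lo hi A C zstar)
  (hK : normalizing lo hi A C zstar K)
  (beta : R) (hbeta : 0 < beta < 1) :
  exists M : R, 0 < M /\
    exists N0 : nat, forall N : nat, (0 < N)%nat -> (N0 <= N)%nat ->
      forall z : R, 0 <= z <= 1 ->
        Rabs (steady_state A C zstar K N z - normal_approx A C zstar K N z)
          <= M / Rpower (INR N) beta.
Proof.
  destruct (normalizing_constant_bound _ _ _ _ _ _ hAC hK) as [M1 [HM1 HKN]].
  destruct (profile_difference _ _ _ _ _ hAC) as [M2 [HM2 Hprof]].
  destruct (large_enough_eventually _ _ _ _ _ hAC) as [N1 HN1].
  exists (M1 * M2). split; [nra |]. exists N1. intros N HN0 HN z Hz.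
  destruct (HKN N (HN1 N HN0 HN)) as [HKpos HKle].
  assert (Hn1 : 1 <= INR N) by (apply (le_INR 1); lia).
  specialize (Hprof (INR N) z ltac:(lra) Hz).
  unfold steady_state, normal_approx.
  set (n := INR N) in *. set (r := sqrt n) in *.
  assert (Hr : 0 < r) by (apply sqrt_lt_R0; lra).
  assert (Hr2 : r * r = n) by (apply sqrt_sqrt; lra).
  unfold Rdiv at 1 2. rewrite !Rmult_assoc, <- !Rmult_minus_distr_l, <- !Rmult_assoc.
  assert (0 < 2 * n * K N) by nra.
  rewrite Rabs_mult, (Rabs_pos_eq (2 * n * K N)) by lra.
  apply (Rle_trans _ (M1 / r * (M2 / r))).
  { apply Rmult_le_compat; trivial; [lra | apply Rabs_pos]. }
  replace (M1 / r * (M2 / r)) with (M1 * M2 / n) by (rewrite <- Hr2; field; lra).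
  assert (Hpow : Rpower n beta <= n).
  { rewrite <- (Rpower_1 n) at 2 by lra. apply Rle_Rpower; lra. }
  apply Rmult_le_compat_l; [nra |].
  apply Rinv_le_contravar; [apply exp_pos | exact Hpow].
Qed.
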